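(* Every numerical semigroup $T$ can be realized as a numerical duplication $S\bowtie^b E$, where $S=\frac{T}{2}$, $b$ is an odd element of $S$, and $E$ is a relative ideal of $S$ such that $b+E+E\subseteq S$.
   Context: $\mathbb{N}$ denotes the non-negative integers. A numerical semigroup is a submonoid of $\mathbb{N}$ with finite complement in $\mathbb{N}$. For a numerical semigroup $T$, $\frac{T}{2}=\{s\in\mathbb{N}\mid 2s\in T\}$. A relative ideal of a numerical semigroup $S$ is a nonempty set $E\subseteq\mathbb{Z}$ such that $E+S\subseteq E$ and $x+E\subseteq S$ for some $x\in S$. Given $S$, an odd $b\in S$ and a relative ideal $E$ of $S$ with $b+E+E\subseteq S$, the numerical duplication of $S$ with respect to $E$ is the numerical semigroup $S\bowtie^b E=2\cdot S\cup(2\cdot E+b)$, where $2\cdot X=\{2x\mid x\in X\}$. *)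

(* Defs.v *)
From HB Require Import structures.
From mathcomp Require Import all_boot all_order all_algebra.
From mathcomp Require Import boolp classical_sets functions cardinality.
Set Implicit Arguments.
Unset Strict Implicit.
Unset Printing Implicit Defensive.
Import Order.TTheory GRing.Theory Num.Theory.
Local Open Scope classical_set_scope.
Local Open Scope ring_scope.

Definition numerical_semigroup (S : set nat) : Prop :=
  [/\ S 0%N,
      forall x y : nat, S x -> S y -> S (x + y)%N
    & finite_set (~` S)].

Definition half_semigroup (T : set nat) : set nat :=
  [set s : nat | T (2 * s)%N].

Definition set_int (A : set nat) : set int := [set n%:Z | n in A].

Definition relative_ideal (S : set nat) (E : set int) : Prop :=
  [/\ E !=set0,
      [set e + s | e in E & s in set_int S] `<=` E
    & exists2 x : nat, S x & [set x%:Z + e | e in E] `<=` set_int S].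

(* Valued in [set int] because [E] may contain negative integers; the
   condition b + E + E `<=` S forces 2 * e + b >= 0 for every e in E. *)
Definition numerical_duplication (S : set nat) (b : nat) (E : set int) :
    set int :=
  [set 2 * s | s in set_int S] `|` [set 2 * e + b%:Z | e in E].

(* Main.v *)
Require Import Defs.
From HB Require Import structures.
From mathcomp Require Import all_boot all_order all_algebra.
From mathcomp Require Import boolp classical_sets functions cardinality.
From mathcomp Require Import zify.
Set Implicit Arguments.
Unset Strict Implicit.
Unset Printing Implicit Defensive.
Import Order.TTheory GRing.Theory Num.Theory.
Local Open Scope classical_set_scope.
Local Open Scope ring_scope.

(** Take an odd [b] beyond the largest gap of [T], and let [E] be the set of
    integers [e] with [2e + b] in [T]. Since [b] itself lies in [T], both
    [2(b + e) = (2e + b) + b] and [2(b + e + e') = (2e + b) + (2e' + b)] are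
    sums of elements of [T], so [b + E] and [b + E + E] lie in [T/2]. *)

Lemma cofinite_nat_ge (A : set nat) :
  finite_set (~` A) -> exists N : nat, forall n, (N <= n)%N -> A n.
Proof.
move=> /finite_seqP[s sE]; exists (\max_(i <- s) i).+1 => n ltn.
apply: contrapT => nAn; have : (~` A) n by [].
rewrite sE /= => ns; move: ltn; rewrite ltnNge => /negP; apply.
exact: (@leq_bigmax_seq _ s xpredT id n ns).
Qed.

Lemma half_numerical_semigroup (T : set nat) :
  numerical_semigroup T -> numerical_semigroup (half_semigroup T).
Proof.
case=> T0 TD Tfin; split; rewrite /half_semigroup /=.
- by rewrite muln0.
- by move=> x y Tx Ty; rewrite mulnDr; exact: TD.
(* The gaps of [T/2] are the preimage of the gaps of [T] under doubling, which is injective. *)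
- rewrite -[~` _]/((muln 2) @^-1` (~` T)).
  by apply: finite_preimage => // x y _ _; lia.
Qed.

(** Since [2 * z] is a natural number, [z] is nonnegative and its absolute value serves as witness.
    Membership of an integer in [T/2] thus reduces to writing its double as an element of [T]. *)
Lemma set_int_half (T : set nat) (t : nat) (z : int) :
  T t -> t%:Z = 2 * z -> set_int (half_semigroup T) z.
Proof.
move=> Tt tz; exists `|z|%N; last by lia.
by rewrite /half_semigroup /= (_ : (2 * `|z|)%N = t); last lia.
Qed.

Theorem proposition3p3 (T : set nat) (hT : numerical_semigroup T) :
  let S := half_semigroup T in
  numerical_semigroup S /\
  exists (b : nat) (E : set int),
    [/\ S b,
        odd b,
        relative_ideal S E,
        [set b%:Z + e + e' | e in E & e' in E] `<=` set_int S
      & set_int T = numerical_duplication S b E].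
Proof.
move=> S; split; first exact: half_numerical_semigroup.
have [T0 TD Tfin] := hT.
have [N TN] := cofinite_nat_ge Tfin.
(* Both [b] and [2 * b] are at least [N], which puts [b] in [T] and in [S]. *)
pose b := N.*2.+1.
have Tb : T b by apply: TN; rewrite /b; lia.
have Sb : S b by apply: TN; rewrite /b; lia.
exists b, [set e : int | exists2 t : nat, T t & t%:Z = 2 * e + b%:Z].
split=> //.
- by rewrite /b /= odd_double.
- split.
  + by exists 0, b => //; lia.
  + move=> _ [e [t Tt te] [_ [s Ss <-] <-]].
    by exists (t + 2 * s)%N; [exact: TD | lia].
  + exists b => // _ [e [t Tt te] <-].
    by apply: (set_int_half (TD _ _ Tt Tb)); lia.
- move=> _ [e [t Tt te] [e' [t' Tt' te'] <-]].
  by apply: (set_int_half (TD _ _ Tt Tt')); lia.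
- apply/seteqP; split=> [_ [t Tt <-]|z [[_ [s Ss <-] <-]|[e [t Tt te] <-]]].
  + have [tO|tE] := boolP (odd t).
    (* As [t = 2 * t./2 + 1] and [b = 2 * N + 1], solving [t = 2 * e + b] gives [e = t./2 - N],
       negative when [t < b]. *)
    * right; exists ((t./2)%:Z - N%:Z); last by rewrite /b; lia.
      by exists t => //; rewrite /b; lia.
    * left; exists (t./2)%:Z; last by lia.
      by apply: (set_int_half Tt); lia.
  + by exists (2 * s)%N => //; lia.
  + by exists t.
Qed.
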